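(* Let $G$ be a graph and $(H, f)$ be a valued cover of $G$. Let $\mathscr{D} = \{v \in V(G) \mid f(v, 1) + f(v, 2) + \dots + f(v, s) \geq \deg_{G}(v)\}$. If $(H, f)$ is a minimal non-strictly $f$-degenerate pair and $B$ is a nonempty subset of $\mathscr{D}$ with $G[B]$ having no cut vertex, then $G[B]$ is a cycle, or a complete graph, or $\deg_{G[B]}(v) \leq \max_{q} \{f(v, q)\}$ for each $v \in B$, where the maximum is over $q \in \{1, \dots, s\}$.
   Context: All graphs are simple, finite and undirected; $s$ is a positive integer. A cover of a graph $G$ is a graph $H$ with vertex set $\bigcup_{v \in V(G)} X_v$, where $X_v = \{(v,1), \dots, (v,s)\}$, and edge set $\bigcup_{uv \in E(G)} \mathscr{M}_{uv}$, where each $\mathscr{M}_{uv}$ is a (possibly empty) matching between $X_u$ and $X_v$. A valued cover of $G$ is a pair $(H, f)$ with $H$ a cover of $G$ and $f$ a function from $V(H)$ to the nonnegative integers; write $f(v,q)$ for $f((v,q))$. A set $R \subseteq V(H)$ is a transversal of $H$ if $|R \cap X_v| = 1$ for each $v \in V(G)$. A graph with a nonnegative integer valued function $f$ on its vertices is strictly $f$-degenerate if every nonempty subgraph $\Gamma$ of it has a vertex $x$ with $\deg_\Gamma(x) < f(x)$. A transversal $R$ is a strictly $f$-degenerate transversal if the induced subgraph $H[R]$ is strictly $f$-degenerate. $G[B]$ denotes the subgraph of $G$ induced by $B$. The pair $(H, f)$ is minimal non-strictly $f$-degenerate if $H$ has no strictly $f$-degenerate transversal, but $(H - X_v, g)$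 has a strictly $g$-degenerate transversal for each $v \in V(G)$, where $g$ is the restriction of $f$ to $V(H) \setminus X_v$.
   Formalization: A cut vertex of G[B] is taken to be a vertex whose deletion leaves a disconnected graph, so G[B] is in effect required to be connected (or two isolated vertices); for disconnected G[B], such as two disjoint triangles, the claim can fail. *)

(* Defs.v *)
From mathcomp Require Import all_boot.

Set Implicit Arguments.
Unset Strict Implicit.
Unset Printing Implicit Defensive.

Record sgraph (V : finType) := SGraph {
  adj :> rel V;
  adj_sym : symmetric adj;
  adj_irr : irreflexive adj }.

Section Graphs.
Variable V : finType.
Implicit Types (G K : sgraph V) (A B R : {set V}) (f : V -> nat).

Definition induced_rel G B : rel V := [rel x y | [&& x \in B, y \in B & G x y]].

Lemma induced_sym G B : symmetric (induced_rel G B).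
Proof. by move=> x y; rewrite /induced_rel /= (adj_sym G x y) andbCA. Qed.

Lemma induced_irr G B : irreflexive (induced_rel G B).
Proof. by move=> x; rewrite /induced_rel /= (adj_irr G x) !andbF. Qed.

(* G[B]: it lives on the ambient type V, so the vertex set B has to be carried
   along; the vertices outside B are isolated and must be ignored. *)
Definition induced G B : sgraph V := SGraph (@induced_sym G B) (@induced_irr G B).

Definition deg G x := #|[set y | G x y]|.

(* The graph with vertex set A and edges K is a subgraph of G[R]; it need not
   be an induced subgraph. *)
Definition subgraph_of_induced G R A K : Prop :=
  A \subset R /\ forall x y, K x y -> [/\ x \in A, y \in A & G x y].

(* G[R] is strictly f-degenerate. *)
Definition strictly_degenerate G R f : Prop :=
  forall A K, subgraph_of_induced G R A K -> A != set0 ->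
    exists2 x, x \in A & deg K x < f x.

(* G[A] is connected; the empty graph counts as connected. *)
Definition connected_on G A : Prop :=
  {in A &, forall x y, connect (induced G A) x y}.

(* x is a cut vertex of G[B] if its deletion leaves a disconnected graph.  For
   connected G[B] this agrees with "its deletion increases the number of
   components".  For disconnected G[B] it does not: a disjoint union of two
   triangles has no cut vertex when components are counted, whereas here each
   of its vertices is one.  Graphs without cut vertices in the present sense
   are connected, or consist of two isolated vertices. *)
Definition cut_vertex G B x : Prop :=
  x \in B /\ ~ connected_on G (B :\ x).

Definition is_cycle G B : Prop :=
  exists p : seq V, [/\ uniq p, 2 < size p, p =i B &
    {in B &, forall x y, G x y = (y == next p x) || (x == next p y)}].

Definition is_complete G B : Prop :=
  {in B &, forall x y, x != y -> G x y}.

End Graphs.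

Section Covers.
Variables (V : finType) (s : nat).
Implicit Types (G : sgraph V) (H : sgraph (V * 'I_s)%type).
Implicit Types (f : V * 'I_s -> nat) (R : {set V * 'I_s}).

(* X_v is the fibre of fst over v; the indices 1..s are shifted to 0..s-1. *)
Definition fibre (v : V) : {set V * 'I_s} := [set p | p.1 == v].

(* Edges of H lie over edges of G, and those between two fibres form a
   matching. *)
Definition is_cover G H : Prop :=
  (forall p q, H p q -> G p.1 q.1) /\
  (forall p q r, H p q -> H p r -> q.1 = r.1 -> q = r).

(* R is a transversal of the part of the cover lying over A. *)
Definition transversal_on (A : {set V}) R : Prop :=
  (forall p, p \in R -> p.1 \in A) /\
  (forall v, v \in A -> #|R :&: fibre v| = 1).

Definition has_sd_transversal H f (A : {set V}) : Prop :=
  exists R, transversal_on A R /\ strictly_degenerate H R f.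

(* H - X_v is the part of H over V - v; no restriction of f is needed, as only
   the values of f on the transversal matter. *)
Definition minimal_non_sd H f : Prop :=
  ~ has_sd_transversal H f [set: V] /\
  forall v, has_sd_transversal H f [set~ v].

Definition large_value_set G f : {set V} :=
  [set v | deg G v <= \sum_(q < s) f (v, q)].

End Covers.

(* Main.v *)
Require Import Defs.
From mathcomp Require Import all_boot zify.

(* Deleting the vertices outside B, coloured by a strictly degenerate transversal
   R, and lowering each value f(v,q) by the number of neighbours of (v,q) in R,
   leaves a pair over G[B] without strictly degenerate transversal in which the
   values at v still sum to at least deg_{G[B]}(v).  In such a pair over a connected
   graph the greedy procedure forces equality of sum and degree; hence in the
   2-connected case each (v,q) of positive value is matched, along every edge vu, to
   some (u,r) of positive value, and all vertices have the same number k of positive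
   values.  If k <= 1 the sum is a maximum.  If k >= 2, induct on the number of
   vertices: a 2-connected graph that is neither a cycle nor complete has a maximal
   proper 2-connected induced subgraph W', whose complement is an open ear.  Colouring
   the ear makes W' a cycle or complete; the positive values at the feet of the ear
   must be at least 2, so these feet have degree at least 4 and W' is complete, and
   deleting suitable vertices of W' then contradicts the induction hypothesis.  Only
   an ear with a single vertex, joined to all of W', needs a separate argument. *)

Set Implicit Arguments.
Unset Strict Implicit.
Unset Printing Implicit Defensive.

Lemma card_setD1_gt (T : finType) n (A : {set T}) x :
  n.+1 < #|A| -> n < #|A :\ x|.
Proof. by rewrite (cardsD1 x A); case: (x \in A) => //; apply: ltnW. Qed.

(** * Connectivity of vertex sets, tested on cuts *)

Section Connectivity.
Variables (V : finType) (G : sgraph V).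
Implicit Types (A B P Q S T W X Y : {set V}) (a c p u v w x y z : V).

Definition nb A v := [set y in A | G v y].
Definition dg A v := #|nb A v|.

(* Connectivity of G[A] in terms of cuts; it is boolean, so that extremal
   connected sets can be chosen. *)
Definition conn A : bool :=
  [forall X : {set V}, [&& X \subset A, X != set0 & X != A] ==>
     [exists x in X, exists y in A :\: X, G x y]].

Definition two_conn A : bool := (2 < #|A|) && [forall x in A, conn (A :\ x)].

Lemma in_nb A v y : (y \in nb A v) = (y \in A) && G v y.
Proof. by rewrite inE. Qed.

Lemma connP A :
  reflect (forall X, X \subset A -> X != set0 -> X != A ->
             exists x y, [/\ x \in X, y \in A, y \notin X & G x y])
          (conn A).
Proof.
apply: (iffP forallP) => [cA X XA X0 XnA | cA X].
  have /implyP := cA X; rewrite XA X0 XnA => /(_ isT) /exists_inP [x xX].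
  by case/exists_inP => y; rewrite inE => /andP [yX yA] xy; exists x, y.
apply/implyP => /and3P [XA X0 XnA].
have [x [y [xX yA yX xy]]] := cA X XA X0 XnA.
by apply/exists_inP; exists x => //; apply/exists_inP; exists y; rewrite // inE yX.
Qed.

Lemma conn_from A v : v \in A ->
  (forall X, X \subset A -> v \in X -> X != A ->
     exists x y, [/\ x \in X, y \in A, y \notin X & G x y]) -> conn A.
Proof.
move=> vA cA; apply/connP => X XA X0 XnA.
have [vX|vX] := boolP (v \in X); first exact: cA.
have [|||x [y [xX yA yX xy]]] := cA (A :\: X).
- exact: subsetDl.
- by rewrite inE vX.
- apply: contraNneq X0 => eqA; rewrite -subset0; apply/subsetP => x xX.
  by have := subsetP XA _ xX; rewrite -eqA inE xX.
move: xX yX; rewrite !inE yA andbT negbK => /andP [xX xA] yX.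
by exists y, x; split; rewrite // (adj_sym G).
Qed.

Lemma conn_on A : connected_on G A <-> conn A.
Proof.
split=> [cA | cA x y xA yA].
  apply/connP => X XA X0 XnA.
  have /subsetPn [y yA yX] : ~~ (A \subset X).
    by apply: contra XnA => AX; rewrite eqEsubset XA.
  have /set0Pn [x xX] := X0.
  have [/exists_inP [x' x'X /exists_inP [y']] | nE] :=
      boolP [exists x' in X, exists y' in A :\: X, G x' y'].
    by rewrite inE => /andP [y'X y'A] xy; exists x', y'.
  have cl : closed (induced G A) X.
    apply: intro_closed.
      by apply: sym_connect_sym; exact: induced_sym.
    move=> u v /= /and3P [_ vA uv] uX; apply: contraR nE => vX.
    by apply/exists_inP; exists u => //; apply/exists_inP; exists v; rewrite // inE vX.
  have := closed_connect cl (cA x y (subsetP XA _ xX) yA).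
  by rewrite xX (negbTE yX).
pose X := [set z in A | connect (induced G A) x z].
have [XA|XnA] := eqVneq X A; first by move: yA; rewrite -{1}XA inE => /andP [].
have xX : x \in X by rewrite inE xA connect0.
have XA : X \subset A by apply/subsetP => z; rewrite inE => /andP [].
have [|u [v [uX vA vX uv]]] := connP _ cA X XA _ XnA.
  by apply/set0Pn; exists x.
case/negP: vX; move: uX; rewrite !inE vA /= => /andP [uA xu].
by apply: connect_trans xu _; apply: connect1; apply/and3P.
Qed.

Lemma conn1 x : conn [set x].
Proof.
apply/connP => X; rewrite subset1 => /orP [/eqP -> | /eqP ->]; by rewrite eqxx.
Qed.

Lemma connU A B a b : conn A -> conn B -> a \in A -> b \in B ->
  (a == b) || G a b -> conn (A :|: B).
Proof.
move=> /connP cA /connP cB aA bB ab.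
apply: (@conn_from _ a); rewrite ?inE ?aA // => X XAB aX XnAB.
have [AX|nAX] := boolP (A \subset X); last first.
  have [|||x [y [xX yA yX xy]]] := cA (X :&: A).
  - exact: subsetIr.
  - by apply/set0Pn; exists a; rewrite inE aX.
  - by apply: contraNneq nAX => <-; exact: subsetIl.
  move: xX yX; rewrite !inE yA andbT => /andP [xX xA] yX.
  by exists x, y; split; rewrite // inE yA.
have nBX : ~~ (B \subset X).
  by apply: contraNN XnAB => BX; rewrite eqEsubset XAB subUset AX.
have [bX|bX] := boolP (b \in X); last first.
  exists a, b; split; rewrite // ?inE ?bB ?orbT //.
  by case/orP: ab => // /eqP eab; rewrite -eab aX in bX.
have [|||x [y [xX yB yX xy]]] := cB (X :&: B).
- exact: subsetIr.
- by apply/set0Pn; exists b; rewrite inE bX.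
- by apply: contraNneq nBX => <-; exact: subsetIl.
move: xX yX; rewrite !inE yB andbT => /andP [xX xB] yX.
by exists x, y; split; rewrite // inE yB orbT.
Qed.

Lemma connU1 A a y : conn A -> a \in A -> G a y -> conn (y |: A).
Proof.
move=> cA aA ay; rewrite setUC.
by apply: (connU cA (conn1 y) aA (set11 y)); rewrite ay orbT.
Qed.

Lemma conn_dominating A b : b \in A -> {in A, forall x, x != b -> G b x} -> conn A.
Proof.
move=> bA dom; apply: (@conn_from _ b) => // X XA bX XnA.
have /subsetPn [y yA yX] : ~~ (A \subset X).
  by apply: contra XnA => AX; rewrite eqEsubset XA.
by exists b, y; split=> //; apply: dom => //; apply: contraNneq yX => ->.
Qed.

(** Each side of an uncrossed cut of [A :\ c] must send an edge to [c], as [A] is connected; the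
    ends of these two edges are neighbours of [c], hence adjacent, and cross the cut. *)
Lemma conn_simplicial A c : c \in A -> conn A ->
  {in nb A c &, forall x y, x != y -> G x y} -> conn (A :\ c).
Proof.
move=> cA /connP cnA simp; apply/connP => X XA X0 XnA.
have [/existsP [x /existsP [y /and4P [xX yA yX xy]]] | nE] :=
    boolP [exists x, exists y, [&& x \in X, y \in A :\ c, y \notin X & G x y]].
  by exists x, y.
have nXY x y : x \in X -> y \in A -> y != c -> y \notin X -> G x y = false.
  move=> xX yA yc yX; apply: contraNF nE => xy.
  by apply/existsP; exists x; apply/existsP; exists y; rewrite xX !inE yc yA yX.
have cX : c \notin X by apply/negP => /(subsetP XA); rewrite !inE eqxx.
have XA' : X \subset A by apply: subset_trans XA (subsetDl _ _).
have [|x [y [xX yA yX xy]]] := cnA X XA' X0; first by apply: contraNneq cX => ->.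
have yc : y = c by apply/eqP; apply: contraLR xy => yc; rewrite nXY.
subst y => {yA yX}.
have Y0 : A :\ c :\: X != set0.
  by rewrite setD_eq0; apply: contra XnA => AX; rewrite eqEsubset XA.
have [|||u [v [uY vA vY uv]]] := cnA (A :\ c :\: X).
- exact: subset_trans (subsetDl _ _) (subsetDl _ _).
- exact: Y0.
- by apply: contraTneq cA => <-; rewrite !inE eqxx andbF.
move: uY vY; rewrite !inE vA andbT => /and3P [uX uc uA].
rewrite negb_and !negbK => /orP [vX | /eqP vc].
  by move: uv; rewrite (adj_sym G) nXY.
subst v; case/negP: nE.
apply/existsP; exists x; apply/existsP; exists u; rewrite xX !inE uc uA uX /=.
apply: simp; rewrite ?in_nb ?(subsetP XA' _ xX) ?uA /= 1?(adj_sym G) //.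
by apply: contraNneq uX => <-.
Qed.

(** A largest connected proper subset of [P] containing [z] misses only one vertex: adding an
    adjacent vertex of [P] must give all of [P]. *)
Lemma conn_noncut P z : conn P -> z \in P -> 1 < #|P| ->
  exists2 y, y \in P & (y != z) && conn (P :\ y).
Proof.
move=> cP zP P1.
pose ok T := [&& z \in T, conn T & T \proper P].
have ok1 : ok [set z].
  rewrite /ok inE eqxx conn1 properE sub1set zP /=.
  by apply: contraL P1 => /subset_leq_card; rewrite cards1 -leqNgt.
case: (@arg_maxnP _ [set z] ok (fun T => #|T|) ok1) => T /and3P [zT cT /properP [TP [y yP yT]]] Tmax.
have [||u [v [uT vP vT uv]]] := connP _ cP T TP.
- by apply/set0Pn; exists z.
- by apply: contraNneq yT => ->.
exists v => //; apply/andP; split; first by apply: contraNneq vT => ->.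
have cvT : conn (v |: T) by apply: connU1 cT uT uv.
suff -> : P :\ v = T by [].
have vTP : v |: T \subset P by rewrite subUset sub1set vP TP.
have : ~~ (v |: T \proper P).
  apply/negP => pr; have := Tmax (v |: T).
  by rewrite /ok inE zT orbT cvT pr cardsU1 vT add1n => /(_ isT); rewrite /= ltnn.
rewrite properEneq vTP andbT negbK => /eqP <-.
by apply: setU1K.
Qed.


(** * Neighbourhoods and degrees within a vertex set *)

Lemma nbU A B v : nb (A :|: B) v = nb A v :|: nb B v.
Proof. by apply/setP => y; rewrite !inE andb_orl. Qed.

Lemma nb_sub A B v : A \subset B -> nb A v \subset nb B v.
Proof.
by move=> AB; apply/subsetP => y; rewrite !inE => /andP [/(subsetP AB) -> ->].
Qed.

Lemma dg_sub A B v : A \subset B -> dg A v <= dg B v.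
Proof. by move=> AB; apply: subset_leq_card; apply: nb_sub. Qed.

Lemma dgD A B v : B \subset A -> dg A v = dg B v + dg (A :\: B) v.
Proof.
move=> BA; rewrite /dg -(cardsID B (nb A v)); congr (_ + _); apply: eq_card => y.
  by rewrite !inE andbC andbA; case: (boolP (y \in B)) => // /(subsetP BA) ->.
by rewrite !inE andbA.
Qed.

Lemma dg1 x v : dg [set x] v = G v x.
Proof.
rewrite /dg /nb; case vx: (G v x).
  by rewrite (_ : [set _ in _ | _] = [set x]) ?cards1 //;
    apply/setP => y; rewrite !inE; case: eqP => // ->.
apply: eq_card0 => y; rewrite !inE; case: eqP => // ->; exact: vx.
Qed.

Lemma dgD1 A x v : x \in A -> dg A v = G v x + dg (A :\ x) v.
Proof. by move=> xA; rewrite (@dgD _ [set x]) ?sub1set // dg1. Qed.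

Lemma dg_setD1_gt n A x v : n.+1 < dg A v -> n < dg (A :\ x) v.
Proof.
move=> h; have -> : dg (A :\ x) v = #|nb A v :\ x|; last exact: card_setD1_gt.
by apply: eq_card => y; rewrite !inE andbA.
Qed.

Lemma dg_le_card A x : x \in A -> dg A x < #|A|.
Proof.
move=> xA; apply: proper_card; rewrite properE; apply/andP; split.
  by apply/subsetP => y; rewrite inE => /andP [].
by apply/subsetPn; exists x; rewrite // inE adj_irr andbF.
Qed.

Definition completeb A : bool :=
  [forall x in A, forall y in A, (x != y) ==> G x y].

Lemma completeP A : reflect (is_complete G A) (completeb A).
Proof.
apply: (iffP forall_inP) => [cA x y xA yA xy | cA x xA].
  by have /forall_inP /(_ y yA) /implyP := cA x xA; apply.
by apply/forall_inP => y yA; apply/implyP; apply: cA.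
Qed.

Lemma conn_nb A x : conn A -> x \in A -> 1 < #|A| -> exists2 y, y \in A & G x y.
Proof.
move=> /connP cA xA A1.
have [|||x' [y [+ yA _]]] := cA [set x].
- by rewrite sub1set.
- by apply/set0Pn; exists x; rewrite inE.
- by apply: contraTneq A1 => <-; rewrite cards1.
by rewrite inE => /eqP -> xy; exists y.
Qed.

Lemma card2P A : 1 < #|A| -> exists x y, [/\ x \in A, y \in A & x != y].
Proof.
move=> A1; have /card_gt0P [x xA] := ltnW A1.
have /card_gt0P [y] := card_setD1_gt x A1.
by rewrite !inE => /andP [yx yA]; exists x, y; rewrite eq_sym.
Qed.

(** * 2-connected sets and ears *)

Lemma two_conn_conn A : two_conn A -> conn A.
Proof.
case/andP=> A2 /forall_inP cA.
have /card_gt0P [x xA] := ltnW (ltnW A2).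
have cAx := cA x xA.
have Ax : 1 < #|A :\ x| by apply: card_setD1_gt.
have [y [z [yA zA yz]]] := card2P Ax.
have [|||w wA yw] := @conn_nb (A :\ z) x; first exact: cA (subsetP (subsetDl _ _) _ zA).
- by move: zA; rewrite !inE => /andP [zx _]; rewrite eq_sym zx.
- exact: card_setD1_gt.
rewrite -(setD1K xA); apply: (connU1 cAx (_ : w \in _)); last by rewrite (adj_sym G).
move: wA; rewrite !inE => /andP [_ ->]; rewrite andbT.
by apply: contraTneq yw => ->; rewrite adj_irr.
Qed.

Lemma two_connD1 A x : two_conn A -> conn (A :\ x).
Proof.
move=> tA; have [xA|xA] := boolP (x \in A); first by case/andP: tA => _ /forall_inP; apply.
suff -> : A :\ x = A by apply: two_conn_conn.
by apply/setDidPl; rewrite disjoint_sym disjoints1.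
Qed.

Lemma two_conn_dg A x : two_conn A -> x \in A -> 1 < dg A x.
Proof.
move=> tA xA; have A2 : 2 < #|A| by case/andP: tA.
have [|y yA xy] := conn_nb (two_conn_conn tA) xA; first exact: ltnW.
have [||w] := @conn_nb (A :\ y) x (two_connD1 y tA).
- by rewrite !inE xA andbT; apply: contraTneq xy => ->; rewrite adj_irr.
- exact: card_setD1_gt.
rewrite (dgD1 x yA) xy add1n ltnS => wA xw; apply/card_gt0P.
by exists w; rewrite inE wA.
Qed.

(* If [P] were cut by [y] into pieces one of which sends no edge to [W], then
   deleting that piece would leave a smaller connected set attached to [W] in the
   same way. *)
Lemma conn_ear W P y w : conn W -> w \in W -> conn P -> [disjoint W & P] ->
  (forall Q, Q \proper P -> Q != set0 -> conn Q ->
     exists p x, [/\ p \in P, p \notin Q, x \in W & G p x]) ->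
  y \in P -> conn (W :|: (P :\ y)).
Proof.
move=> /connP cW wW /connP cP dWP minP yP.
apply: (@conn_from _ w); first by rewrite inE wW.
move=> X XWP wX XnWP.
have [/existsP [u /existsP [v /and4P [uX vA vX uv]]] | nE] :=
    boolP [exists u, exists v, [&& u \in X, v \in W :|: P :\ y, v \notin X & G u v]].
  by exists u, v.
have nX u v : u \in X -> v \in W :|: P :\ y -> v \notin X -> G u v = false.
  move=> uX vA vX; apply: contraNF nE => uv.
  by apply/existsP; exists u; apply/existsP; exists v; rewrite uX vA vX.
have WX : W \subset X.
  apply/negPn/negP => nWX; have [|||u [v [uX vW vX uv]]] := cW (X :&: W).
  - exact: subsetIr.
  - by apply/set0Pn; exists w; rewrite inE wX.
  - by apply: contraNneq nWX => <-; exact: subsetIl.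
  move: uX vX; rewrite !inE vW andbT => /andP [uX _] vX.
  by rewrite nX ?inE ?vW in uv.
pose A := P :\ y :\: X.
have nW p : p \in P -> p \notin W.
  by move=> pP; apply/negP => pW; move/pred0P: dWP => /(_ p); rewrite /= pW pP.
have [||| p [x [pP pA xW px]]] := minP (P :\: A).
- rewrite properE subsetDl /=; apply/subsetPn.
  have /subsetPn [v vA vX] : ~~ (W :|: P :\ y \subset X).
    by apply: contra XnWP => AX; rewrite eqEsubset XWP.
  move: vA; rewrite in_setU => /orP [/(subsetP WX) vX'|vP]; first by rewrite vX' in vX.
  have vA : v \in A by rewrite /A in_setD vX vP.
  by exists v; [move: vP; rewrite !inE => /andP [] | rewrite in_setD vA].
- by apply/set0Pn; exists y; rewrite !inE eqxx yP andbF.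
- apply: (@conn_from _ y) => [|Y YP yY YnP]; first by rewrite !inE eqxx yP andbF.
  have sP : P :\: A \subset P by exact: subsetDl.
  have /subsetPn [z zP zY] : ~~ (P :\: A \subset Y).
    by apply: contra YnP => PY; rewrite eqEsubset YP.
  have [|||u [v [uY vP vY uv]]] := cP (P :\: A :\: Y).
  + exact: subset_trans (subsetDl _ _) sP.
  + by apply/set0Pn; exists z; rewrite inE zY.
  + by apply: contraTneq yP => <-; rewrite inE yY.
  have [uP uY'] : u \in P :\: A /\ u \notin Y by move: uY; rewrite inE => /andP [].
  have [vA|vA] := boolP (v \in A); last first.
    exists v, u; split; rewrite // 1?(adj_sym G) //.
    by apply: contraNT vY => vY; rewrite in_setD vY in_setD vA.
  have uy : u != y by apply: contraNneq uY' => ->.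
  have uX : u \in X.
    by move: uP; rewrite in_setD => /andP [+ uP]; rewrite /A !inE uy uP !andbT negbK.
  by move: vA; rewrite in_setD => /andP [vX vPy]; rewrite nX ?in_setU ?vPy ?orbT in uv.
have {}pA : p \in A by apply: contraR pA => pA; rewrite inE pA.
move: pA; rewrite in_setD => /andP [pX pPy].
have := nX x p (subsetP WX _ xW) _ pX.
by rewrite in_setU pPy orbT (adj_sym G) px => /(_ isT).
Qed.

(** Let [P] be a smallest connected subset of [W :\ x] with at least two neighbours of [x]. By
    [conn_ear] the set [x |: P] is 2-connected. If it were [W], a non-cut vertex of [P] could be
    dropped, as [x] has three neighbours. *)
Lemma two_conn_proper_sub W x : two_conn W -> x \in W -> 2 < dg W x ->
  exists2 W', two_conn W' & W' \proper W.
Proof.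
move=> tW xW x3.
pose ok P := [&& P \subset W :\ x, conn P & 1 < dg P x].
have dgx : dg W x = dg (W :\ x) x by rewrite (dgD1 x xW) adj_irr.
have ok0 : ok (W :\ x) by rewrite /ok subxx two_connD1 // -dgx ltnW.
case: (@arg_minnP _ (W :\ x) ok (fun P => #|P|) ok0) => P /and3P [PW cP P2] Pmin.
have xP : x \notin P by apply/negP => /(subsetP PW); rewrite !inE eqxx.
have P1 : 1 < #|P|.
  apply: leq_trans P2 _; apply: subset_leq_card; apply/subsetP => y.
  by rewrite inE => /andP [].
have WW : x |: P \subset W.
  by rewrite subUset sub1set xW (subset_trans PW) // subsetDl.
exists (x |: P).
  rewrite /two_conn cardsU1 xP add1n ltnS P1; apply/forall_inP => z.
  rewrite in_setU1; have [-> _|zx /= zP] := eqVneq z x; first by rewrite setU1K.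
  have -> : (x |: P) :\ z = [set x] :|: (P :\ z).
    by apply/setP => y; rewrite !inE; case: (eqVneq y x) => // ->; rewrite eq_sym zx.
  apply: (conn_ear (conn1 x) (set11 x)) => //; first by rewrite disjoints1.
  move=> Q QP Q0 cQ; have [/exists_inP [p pP /andP [pQ px]]|nE] :=
    boolP [exists p in P, (p \notin Q) && G p x].
    by exists p, x; rewrite set11.
  have : #|P| <= #|Q|.
    apply: Pmin; rewrite /ok cQ (subset_trans (proper_sub QP)) //=.
    apply: leq_trans P2 _; apply: subset_leq_card; apply/subsetP => p.
    rewrite !inE => /andP [pP xp]; rewrite xp andbT; apply: contraR nE => pQ.
    by apply/exists_inP; exists p; rewrite // pQ (adj_sym G).
  by rewrite leqNgt proper_card.
rewrite properEneq WW andbT; apply/eqP => eW.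
have eP : P = W :\ x by rewrite -eW setU1K.
have /card_gt0P [z zP] := ltnW P1.
have [y yP /andP [_ cy]] := conn_noncut cP zP P1.
have : #|P| <= #|P :\ y|.
  apply: Pmin; rewrite /ok cy (subset_trans (subsetDl _ _)) //=.
  by apply: dg_setD1_gt; rewrite eP -dgx.
by rewrite (cardsD1 y P) yP add1n ltnn.
Qed.

(** A minimal connected part [P] of [S] attached to two vertices of [W'] makes [W' :|: P]
    2-connected, so [P] is all of [S] because [W'] is largest. If [S] has several vertices, its
    smaller connected subsets thus have at most one attachment; this is applied after deleting
    non-cut vertices of [S]. *)
Lemma two_conn_last_ear W W' : two_conn W -> two_conn W' -> W' \proper W ->
  (forall T, two_conn T -> T \proper W -> #|T| <= #|W'|) ->
  (exists v, W :\: W' = [set v]) \/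
  (exists2 c, c \in W' & dg (W :\: W') c = 0) /\
  {in W', forall a, dg (W :\: W') a <= 1}.
Proof.
move=> tW tW' pW' maxW'; set S := W :\: W'.
have sW' := proper_sub pW'.
have W'3 : 2 < #|W'| by case/andP: tW'.
have SW : S \subset W by exact: subsetDl.
have SW' p : p \in S -> p \notin W' by rewrite inE => /andP [].
have dSW' P : P \subset S -> [disjoint W' & P].
  move=> PS; rewrite disjoint_sym; apply/pred0P => p /=; apply/negP => /andP [pP pW].
  by have := SW' p (subsetP PS _ pP); rewrite pW.
pose att P := [set a in W' | 0 < dg P a].
have attP P a p : a \in W' -> p \in P -> G a p -> a \in att P.
  by move=> aW pP ap; rewrite inE aW; apply/card_gt0P; exists p; rewrite inE pP.
pose ok P := [&& P != set0, P \subset S, conn P & 1 < #|att P|].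
(* A largest connected subset of [S] has two attachments: otherwise some [x] in [W'] covers them
   all, and deleting [x] disconnects [W]. *)
have [P0 okP0] : exists P, ok P.
  have [s sS] : exists s, s \in S.
    by case/properP: pW' => _ [s sW sW'']; exists s; rewrite inE sW''.
  pose ok0 P := [&& P != set0, P \subset S & conn P].
  have ok0s : ok0 [set s].
    by rewrite /ok0 conn1 sub1set sS -card_gt0 cards1.
  case: (@arg_maxnP _ [set s] ok0 (fun P => #|P|) ok0s) => P /and3P [P0 PS cP] Pmax.
  exists P; rewrite /ok P0 PS cP /=; rewrite ltnNge; apply/negP => att1.
  have [x xW attx] : exists2 x, x \in W' & att P \subset [set x].
    have [/eqP a0|] := boolP (att P == set0).
      have /card_gt0P [x xW] := ltnW (ltnW W'3).
      by exists x; rewrite // a0 sub0set.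
    case/set0Pn => x xa; exists x; first by move: xa; rewrite inE => /andP [].
    apply/subsetP => y ya; rewrite inE; apply/eqP.
    by have /card_le1_eqP := att1; apply.
  have [y yW' yx] : exists2 y, y \in W' & y != x.
    have /card_gt0P [y] := card_setD1_gt x (ltnW W'3).
    by rewrite !inE => /andP [yx yW]; exists y.
  have [|||u [v [uP vW vP uv]]] := connP _ (two_connD1 x tW) P.
  - apply/subsetP => p pP; rewrite !inE (subsetP SW _ (subsetP PS _ pP)) andbT.
    by apply: contraTneq xW => <-; apply: SW'; apply: (subsetP PS).
  - exact: P0.
  - apply/eqP => eP; have : y \in P by rewrite eP !inE yx (subsetP sW').
    by move/(subsetP PS)/SW'; rewrite yW'.
  move: vW; rewrite !inE => /andP [vx vW].
  have [vW'|vW'] := boolP (v \in W').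
    have : v \in att P by apply: attP vW' uP _; rewrite (adj_sym G).
    by move/(subsetP attx); rewrite inE (negbTE vx).
  have okv : ok0 (v |: P).
    apply/and3P; split; last exact: connU1 cP uP uv.
      by apply/set0Pn; exists v; rewrite setU11.
    by rewrite subUset PS sub1set inE vW' vW.
  by move: (Pmax _ okv); rewrite /= cardsU1 vP add1n ltnn.
case: (@arg_minnP _ P0 ok (fun P => #|P|) okP0) => P /and4P [Pn0 PS cP attP1] Pmin.
have PW' p : p \in P -> p \notin W' by move=> /(subsetP PS)/SW'.
have tWP : two_conn (W' :|: P).
  apply/andP; split; first by apply: leq_trans W'3 (subset_leq_card (subsetUl _ _)).
  apply/forall_inP => z; rewrite in_setU => /orP [zW|zP].
    have -> : (W' :|: P) :\ z = (W' :\ z) :|: P.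
      apply/setP => y; rewrite !inE; case: (eqVneq y z) => //= ->.
      by apply/esym/negbTE/negP => /PW'; rewrite zW.
    have /card_gt0P [a] := card_setD1_gt z attP1.
    rewrite !inE => /and3P [az aW /card_gt0P [p]]; rewrite inE => /andP [pP ap].
    have aWz : a \in W' :\ z by rewrite !inE az.
    by apply: (connU (two_connD1 z tW') cP aWz pP); rewrite ap orbT.
  have -> : (W' :|: P) :\ z = W' :|: (P :\ z).
    apply/setP => y; rewrite !inE; case: (eqVneq y z) => //= ->.
    by rewrite (negbTE (PW' _ zP)).
  have /card_gt0P [w wW] := ltnW (ltnW W'3).
  apply: (conn_ear (two_conn_conn tW') wW cP) => //; first exact: dSW'.
  move=> Q QP Q0 cQ.
  have [/exists_inP [p pP /andP [pQ /exists_inP [x xW px]]]|nE] :=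
      boolP [exists p in P, (p \notin Q) && [exists x in W', G p x]].
    by exists p, x.
  have : #|P| <= #|Q|.
    apply: Pmin; rewrite /ok cQ Q0 (subset_trans (proper_sub QP)) //=.
    apply: leq_trans attP1 _; apply: subset_leq_card; apply/subsetP => a.
    rewrite inE => /andP [aW /card_gt0P [p]]; rewrite inE => /andP [pP ap].
    apply: (attP _ _ p) => //; apply: contraR nE => pQ.
    apply/exists_inP; exists p; rewrite // pQ; apply/exists_inP; exists a => //.
    by rewrite (adj_sym G).
  by rewrite leqNgt proper_card.
have eP : P = S.
  have sWP : W' :|: P \subset W by rewrite subUset sW' (subset_trans PS).
  have [pr|] := boolP (W' :|: P \proper W).
    have := maxW' _ tWP pr; rewrite cardsU.
    have -> : W' :&: P = set0 by apply/disjoint_setI0/dSW'.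
    by rewrite cards0 subn0 -[leqRHS]addn0 leq_add2l leqn0 cards_eq0 (negbTE Pn0).
  rewrite properEneq sWP andbT negbK => /eqP eW.
  rewrite /S -eW setDUl setDv set0U; apply/esym/setDidPl.
  by rewrite disjoint_sym; apply: dSW'.
subst P.
have [/cards1P|S1] := boolP (#|S| == 1); first by left.
have {S1} S2 : 1 < #|S| by rewrite ltn_neqAle eq_sym S1 card_gt0.
have small Q : Q \proper S -> Q != set0 -> conn Q -> #|att Q| <= 1.
  move=> QS Q0 cQ; rewrite leqNgt; apply/negP => aQ.
  have := Pmin Q; rewrite /ok Q0 cQ aQ (proper_sub QS) => /(_ isT) /=.
  by rewrite leqNgt proper_card.
have smallD y : y \in S -> conn (S :\ y) -> #|att (S :\ y)| <= 1.
  move=> yS cy; apply: small => //; first exact: properD1.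
  by rewrite -card_gt0 card_setD1_gt.
have /set0Pn [z zS] := Pn0.
have [y1 y1S /andP [_ c1]] := conn_noncut cP zS S2.
have [y2 y2S /andP [y21 c2]] := conn_noncut cP y1S S2.
have a1 := smallD _ y1S c1; have a2 := smallD _ y2S c2.
right; split=> [|a aW].
  (* At most one attachment comes from [y1] and one from [S :\ y1], while [W'] has three
     vertices. *)
  have : #|att S| <= 2.
    have -> : att S = att [set y1] :|: att (S :\ y1).
      apply/setP => b; rewrite !inE (dgD1 b y1S) addn_gt0 dg1.
      by rewrite andb_orr.
    apply: leq_trans (leq_card_setU _ _) _.
    apply: (leq_add _ a1 : _ <= 1 + 1); apply: small (conn1 _); last by apply/set0Pn; exists y1; rewrite inE.
    by rewrite properEcard sub1set y1S cards1.
  have sA : att S \subset W' by apply/subsetP => b; rewrite inE => /andP [].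
  move=> A2; have /card_gt0P [c] : 0 < #|W' :\: att S|.
    by rewrite cardsD (setIidPr sA) subn_gt0; apply: leq_ltn_trans A2 W'3.
  by rewrite !inE => /andP [+ cW]; rewrite cW lt0n negbK => /eqP c0; exists c.
rewrite leqNgt; apply/negP => a2'.
have /card_gt0P [b] := card_setD1_gt a attP1.
rewrite !inE => /and3P [ba bW /card_gt0P [p]]; rewrite inE => /andP [pS bp].
(* With two neighbours in [S], [a] stays attached after the deletion of any vertex, and [b] does
   unless that vertex is [p]; one of [y1], [y2] differs from [p]. *)
have two y : y \in S -> p != y -> 1 < #|att (S :\ y)|.
  move=> yS py; apply: leq_trans (subset_leq_card (_ : [set a; b] \subset _)).
    by rewrite cards2 eq_sym ba.
  rewrite subUset !sub1set; apply/andP; split.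
    by rewrite inE aW dg_setD1_gt.
  by apply: (attP _ _ p) => //; rewrite in_setD1 py pS.
have [e|n1] := eqVneq p y1.
  by have := two y2 y2S; rewrite e eq_sym y21 ltnNge a2 => /(_ isT).
by have := two y1 y1S n1; rewrite ltnNge a1.
Qed.

(** * Cycles and maximum degree 2 *)

Lemma next_neq_prev (c : seq V) u : uniq c -> 2 < size c -> u \in c ->
  next c u != prev c u.
Proof.
move=> Uc sc uc; case/rot_to: (uc) => i p Ep.
rewrite -(next_rot i Uc) -(prev_rot i Uc); apply/eqP => e.
have := next_prev (_ : uniq (rot i c)) u; rewrite rot_uniq => /(_ Uc).
rewrite -e; move: Uc sc; rewrite -(rot_uniq i) -(size_rot i) Ep.
case: p {Ep e} => [|a [|b q]] //=; rewrite eqxx => /and3P [].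
rewrite !inE !negb_or => /and3P [ua ub _] _ _ _.
by rewrite eq_sym (negbTE ua) eqxx => bu; rewrite bu eqxx in ub.
Qed.

(** Two neighbours [y], [z] of [x] are joined by a path in [W :\ x], which closes up through [x].
    The degree bound leaves no other edges at this cycle, so by connectivity it spans [W], without
    chords. *)
Lemma two_conn_cycle W : two_conn W -> {in W, forall v, dg W v <= 2} ->
  is_cycle G W.
Proof.
move=> tW W2; have /card_gt0P [x xW] : 0 < #|W| by case/andP: tW => /ltnW/ltnW.
have [y [z []]] := card2P (two_conn_dg tW xW).
rewrite !inE => /andP [yW xy] /andP [zW xz] yz.
have xn w : G x w -> w != x by apply: contraTneq => ->; rewrite adj_irr.
have cW := (conn_on (W :\ x)).2 (two_connD1 x tW).
have yWx : y \in W :\ x by rewrite !inE yW xn.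
have zWx : z \in W :\ x by rewrite !inE zW xn.
have /connectP [p0 pp0 ez] := cW y z yWx zWx.
case/shortenP: pp0 ez => p pp Up _ ez {p0}.
have pG : path G y p by apply: sub_path pp => u v /and3P [].
have pW : {subset y :: p <= W :\ x}.
  move=> u; rewrite inE => /predU1P [-> | up]; first by rewrite !inE yW xn.
  elim: p y pp up {yWx Up ez pG xy yW yz} => //= v p IH y /andP [/and3P [_ vW _] vp].
  by rewrite inE => /predU1P [-> | /(IH v vp)].
pose c := x :: y :: p.
have Uc : uniq c by rewrite /c cons_uniq Up andbT; apply/negP => /pW; rewrite !inE eqxx.
have sc : 2 < size c.
  by rewrite /c; case: (p) ez => /= [e|]; rewrite // e eqxx in yz.
have cc : cycle G c by rewrite /= xy rcons_path pG -ez (adj_sym G) xz.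
have cW' : {subset c <= W}.
  by move=> u; rewrite inE => /predU1P [-> // | /pW]; rewrite !inE => /andP [].
have nbc u : u \in c -> nb W u = [set next c u; prev c u].
  move=> uc; apply/esym/eqP; rewrite eqEcard; apply/andP; split.
    rewrite subUset !sub1set !inE (next_cycle cc uc) (adj_sym G u) (prev_cycle cc uc).
    by rewrite !cW' ?mem_next ?mem_prev.
  by rewrite cards2 (next_neq_prev Uc sc uc); apply: W2; apply: cW'.
have cWi : c =i W.
  move=> u; apply/idP/idP; first exact: cW'.
  have [<-|nW] := eqVneq [set w in c] W; first by rewrite inE.
  have [|||a [b [ac bW bc ab]]] := connP _ (two_conn_conn tW) [set w in c].
  - by apply/subsetP => w; rewrite inE; apply: cW'.
  - by apply/set0Pn; exists x; rewrite !inE eqxx.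
  - exact: nW.
  rewrite inE in ac; rewrite inE in bc; case/negP: bc; have : b \in nb W a by rewrite inE bW.
  by rewrite nbc // in_set2 => /orP [] /eqP ->; rewrite ?mem_next ?mem_prev.
exists c; split=> // u v uW vW.
have uc : u \in c by rewrite cWi.
have -> : G u v = (v \in nb W u) by rewrite inE vW.
rewrite nbc // in_set2; congr (_ || _); apply/eqP/eqP => ->.
  by rewrite next_prev.
by rewrite prev_next.
Qed.
End Connectivity.

(** * Strict degeneracy of induced subgraphs *)

Section Degeneracy.
Variables (T : finType) (K : sgraph T).
Implicit Types (A R : {set T}) (f : T -> nat).

(** Testing induced subgraphs is enough, since removing edges only lowers degrees; see [sdegP]. *)
Definition sdeg R f : Prop :=
  forall A, A \subset R -> A != set0 -> exists2 x, x \in A & dg K A x < f x.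

Lemma deg_induced A x : x \in A -> deg (induced K A) x = dg K A x.
Proof. by move=> xA; apply: eq_card => y; rewrite !inE /=; rewrite /induced_rel /= xA. Qed.

Lemma sdegP R f : strictly_degenerate K R f <-> sdeg R f.
Proof.
split=> [sR A AR A0 | sR A L [AR LA] A0].
  have [|//|x xA] := sR A (induced K A); last by rewrite deg_induced //; exists x.
  by split=> // x y /and3P [].
have [x xA dx] := sR A AR A0; exists x => //; apply: leq_ltn_trans dx.
apply: subset_leq_card; apply/subsetP => y; rewrite !inE => /LA [_ yA xy].
by rewrite yA.
Qed.

(** The subtraction is truncated; a vertex of value 0 lies in no set that is strictly degenerate for
    [red R f]. *)
Definition red R f x := f x - dg K R x.

Lemma sdeg1 x f : 0 < f x -> sdeg [set x] f.
Proof.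
move=> fx A; rewrite subset1 => /orP [/eqP -> _ | /eqP ->]; last by rewrite eqxx.
by exists x; rewrite ?inE // dg1 adj_irr.
Qed.

Lemma sdegW A R f : A \subset R -> sdeg R f -> sdeg A f.
Proof. by move=> AR sR B BA; apply: sR; apply: subset_trans AR. Qed.

(** If [A] meets [R], a vertex of [A :&: R] of small degree there has at most [dg K R0 x] further
    neighbours in [A], which [red] has already deducted. *)
Lemma sdegU R0 R f : sdeg R0 f -> sdeg R (red R0 f) -> sdeg (R0 :|: R) f.
Proof.
move=> s0 sR A AR A0; have [AR0|AR0] := eqVneq (A :&: R) set0.
  apply: s0 => //; apply/subsetP => x xA.
  have := subsetP AR _ xA; rewrite inE => /orP [//|xR].
  have : x \in A :&: R by rewrite inE xA.
  by rewrite AR0 inE.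
have [|x] := sR (A :&: R) _ AR0; first exact: subsetIr.
rewrite inE /red => /andP [xA xR] dx; exists x => //.
suff : dg K A x <= dg K R0 x + dg K (A :&: R) x by lia.
apply: leq_trans (leq_card_setU _ _); rewrite -nbU.
apply: dg_sub; apply/subsetP => y yA; rewrite !inE yA /=.
by have := subsetP AR _ yA; rewrite inE.
Qed.

End Degeneracy.
Arguments sdeg1 {T K x f}.

Lemma setDDD1 (T : finType) (A : {set T}) x : x \in A -> A :\: (A :\ x) = [set x].
Proof. by move=> xA; rewrite setDDr setDv set0U (setIidPr _) ?sub1set. Qed.

(** * Transversals of a cover *)

Section CoverTheory.
Variables (V : finType) (s : nat) (G : sgraph V) (H : sgraph (V * 'I_s)%type).
Hypothesis GH : is_cover G H.
Implicit Types (A S U W : {set V}) (R : {set V * 'I_s}) (f : V * 'I_s -> nat).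
Implicit Types (u v : V) (q r : 'I_s).

Lemma transversal1 v q : transversal_on [set v] [set (v, q)].
Proof.
split=> [p | u] /set1P ->; first by rewrite inE.
by rewrite (setIidPl _) ?cards1 // sub1set inE.
Qed.

Lemma transversal_inj A R : transversal_on A R -> {in R &, injective fst}.
Proof.
case=> RA cR p p' pR p'R e.
have := cR p.1 (RA p pR); move/eqP/cards1P => [x ex].
have : p \in [set x] by rewrite -ex !inE pR eqxx.
have : p' \in [set x] by rewrite -ex !inE p'R -e eqxx.
by rewrite !inE => /eqP -> /eqP ->.
Qed.

Lemma transversalU A W R R' : [disjoint A & W] ->
  transversal_on A R -> transversal_on W R' -> transversal_on (A :|: W) (R :|: R').
Proof.
move=> dAW [RA cR] [RW cR'].
have no U (Q : {set V * 'I_s}) v : (forall p, p \in Q -> p.1 \in U) -> v \notin U ->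
    Q :&: fibre s v = set0.
  move=> QU vU; apply/setP => p; rewrite !inE; apply/negP => /andP [/QU + /eqP pv].
  by rewrite pv (negbTE vU).
split=> [p | v]; rewrite !inE; first by case/orP => [/RA | /RW] ->; rewrite ?orbT.
rewrite setIUl; have [vA _|vA /= vW] := boolP (v \in A).
  rewrite (no W R') ?setU0 ?cR //; apply/negP => vW.
  by move/pred0P: dAW => /(_ v); rewrite /= vA vW.
by rewrite (no A R) // set0U cR'.
Qed.

Lemma transversal_sub A W R : W \subset A -> transversal_on A R ->
  transversal_on W [set p in R | p.1 \in W].
Proof.
move=> WA [RA cR]; split=> [p | v vW]; first by rewrite inE => /andP [].
rewrite -(cR v (subsetP WA _ vW)); apply: eq_card => p; rewrite !inE.
by case: eqP => [-> | _]; rewrite ?andbF // vW andbT.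
Qed.

(* Every vertex of [A] adjacent to [v] is the end of at most one edge from the
   fibre of [v] to [R], because these edges form a matching. *)
Lemma sum_dg_transversal A R v : transversal_on A R ->
  \sum_q dg H R (v, q) <= dg G A v.
Proof.
move=> tR; have [RA _] := tR; have [HG mH] := GH.
have dgE q : dg H R (v, q) = \sum_(p in R) H (v, q) p.
  rewrite /dg -sum1_card (eq_bigl (fun p => (p \in R) && H (v, q) p)); last first.
    by move=> p; rewrite inE.
  by rewrite big_mkcondr; apply: eq_bigr => p _; case: (H _ _).
rewrite (eq_bigr _ (fun q _ => dgE q)) exchange_big /=.
have le p : p \in R -> \sum_q H (v, q) p <= G v p.1.
  move=> pR; have [/existsP [q0 h0]|nE] := boolP [exists q, H (v, q) p].
    rewrite (HG _ _ h0) (bigD1 q0) //= h0 big1 // => q qq0.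
    apply/eqP; rewrite eqb0; apply: contra qq0 => h.
    have := mH p (v, q) (v, q0); rewrite !(adj_sym H p) h h0.
    by move=> /(_ isT isT erefl) [->].
  by rewrite big1 // => q _; apply/eqP; rewrite eqb0; apply: contra nE => h; apply/existsP; exists q.
apply: (@leq_trans (\sum_(p in R) G v p.1)); first exact: leq_sum.
have -> : \sum_(p in R) G v p.1 = #|[set p in R | G v p.1]|.
  rewrite -sum1_card [RHS](eq_bigl (fun p => (p \in R) && G v p.1)); last first.
    by move=> p; rewrite inE.
  by rewrite big_mkcondr; apply: eq_bigr => p _; case: (G _ _).
rewrite -(card_in_imset (f := fst)); last first.
  by move=> p p'; rewrite !inE => /andP [pR _] /andP [p'R _]; apply: transversal_inj tR _ _ pR p'R.
apply: subset_leq_card; apply/subsetP => u /imsetP [p]; rewrite inE => /andP [pR vp] ->.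
by rewrite inE (RA p pR).
Qed.

(** * Bad pairs and greedy colouring *)

Definition solvable W f := exists2 R, transversal_on W R & sdeg H R f.

(** Unlike minimality, this passes to a subset once the rest of [W] is coloured and [f] is reduced;
    see [bad_sub]. *)
Definition bad W f :=
  ~ solvable W f /\ {in W, forall v, dg G W v <= \sum_q f (v, q)}.

Lemma solvableP W f : has_sd_transversal H f W <-> solvable W f.
Proof.
by split=> [[R [tR /sdegP sR]] | [R tR /sdegP sR]]; exists R.
Qed.

(** Some [v] is coloured last. Its cover edges into the transversal [R] of the rest number at most
    its degree, hence fewer than the sum of its values, so some [q] has
    [dg H R (v, q) < f (v, q)]. *)
Lemma greedy W f :
  (forall A, A \subset W -> A != set0 -> exists2 v, v \in A & dg G A v < \sum_q f (v, q)) ->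
  solvable W f.
Proof.
move: {2}#|W| (leqnn #|W|) => n; elim: n W => [|n IH] W cW dW.
  have -> : W = set0 by apply/eqP; rewrite -cards_eq0; lia.
  exists set0; last by move=> A; rewrite subset0 => ->.
  by split=> v; rewrite inE.
have [->|W0] := eqVneq W set0; first by apply: IH => [|A]; rewrite ?cards0 // subset0 => ->.
have [v vW dv] := dW W (subxx _) W0.
have [||R tR sR] := IH (W :\ v).
- by rewrite (cardsD1 v W) vW in cW.
- by move=> A AW; apply: dW; apply: subset_trans AW (subsetDl _ _).
have [/existsP [q dq]|nE] := boolP [exists q, dg H R (v, q) < f (v, q)]; last first.
  have : \sum_q f (v, q) <= \sum_q dg H R (v, q).
    by apply: leq_sum => q _; rewrite leqNgt; apply: contra nE => h; apply/existsP; exists q.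
  have := sum_dg_transversal v tR; rewrite (dgD1 _ v vW) in dv; lia.
exists (R :|: [set (v, q)]).
  rewrite -(setD1K vW) setUC; apply: transversalU tR (transversal1 v q).
  by rewrite disjoint_sym disjoints1 !inE eqxx.
by apply: sdegU sR (sdeg1 _); rewrite /red subn_gt0.
Qed.

Lemma bad_red W0 W R f : W \subset W0 -> ~ solvable W0 f ->
  {in W, forall v, dg G W0 v <= \sum_q f (v, q)} ->
  transversal_on (W0 :\: W) R -> sdeg H R f -> bad W (red H R f).
Proof.
move=> WW n0 dW tR sR; split=> [[R' tR' sR'] | v vW].
  apply: n0; exists (R :|: R'); last exact: sdegU.
  rewrite -(setID W0 W) (setIidPr WW) setUC; apply: transversalU => //.
  by rewrite disjoint_sym disjoints_subset; apply/subsetP => v; rewrite !inE => ->.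
have := dW v vW; rewrite (dgD _ v WW); have := sum_dg_transversal v tR.
suff : \sum_q f (v, q) <= \sum_q red H R f (v, q) + \sum_q dg H R (v, q) by lia.
by rewrite -big_split /=; apply: leq_sum => q _; rewrite /red; lia.
Qed.

(** With slack at [v], every nonempty [A] has a vertex with slack: [v] if [A] is [W], otherwise the
    inner end of an edge leaving [A]. Then [greedy] applies. *)
Lemma bad_tight W f v : conn G W -> bad W f -> v \in W ->
  \sum_q f (v, q) = dg G W v.
Proof.
move=> cW [nW dW] vW; apply/eqP; rewrite eqn_leq dW // andbT leqNgt.
apply/negP => dv; apply: nW; apply: greedy => A AW A0.
have [->|AnW] := eqVneq A W; first by exists v.
have [x [y [xA yW yA xy]]] := connP _ _ cW A AW A0 AnW.
exists x => //; apply: leq_trans (dW x (subsetP AW _ xA)).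
apply: proper_card; rewrite properE nb_sub //=.
by apply/subsetPn; exists y; rewrite !inE ?yW // (negbTE yA).
Qed.

(** Both the pair on [W0] and the reduced pair on [W] are tight, so no subtraction at [v] was
    truncated and every neighbour of [v] in [W0 :\: W] is reached by a cover edge from the fibre of
    [v] to [R]. *)
Lemma bad_tight_red W0 W R f v : conn G W0 -> conn G W -> W \subset W0 -> bad W0 f ->
  transversal_on (W0 :\: W) R -> sdeg H R f -> v \in W ->
  (forall q, dg H R (v, q) <= f (v, q)) /\
  \sum_q dg H R (v, q) = dg G (W0 :\: W) v.
Proof.
move=> c0 cW WW b0 tR sR vW; have vW0 := subsetP WW _ vW.
have [n0 d0] := b0.
have bW : bad W (red H R f).
  by apply: bad_red n0 _ tR sR => // u uW; apply: d0; apply: (subsetP WW).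
have e0 := bad_tight c0 b0 vW0; have eW := bad_tight cW bW vW.
rewrite (dgD _ v WW) in e0; have le := sum_dg_transversal v tR.
have le' (P : pred 'I_s) : \sum_(q | P q) f (v, q) <=
    \sum_(q | P q) red H R f (v, q) + \sum_(q | P q) dg H R (v, q).
  by rewrite -big_split /=; apply: leq_sum => q _; rewrite /red; lia.
split=> [q|]; last by move: (le' xpredT); rewrite e0 eW leq_add2l => h; apply/eqP; rewrite eqn_leq le.
have arith (x y a b A B C : nat) : A <= B + C -> x + A = a + b -> x - y + B = a ->
  y + C <= b -> y <= x by lia.
rewrite (bigD1 q) //= in e0; rewrite (bigD1 q) //= in eW; rewrite (bigD1 q) //= in le.
exact: arith (le' (fun r => r != q)) e0 eW le.
Qed.

(** * Colours of positive value *)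

Definition supp f v := [set q | 0 < f (v, q)].

Lemma supp_red R f v : supp (red H R f) v \subset supp f v.
Proof. by apply/subsetP => q; rewrite !inE /red; lia. Qed.

(** Colour [v] by [q] alone. As [W :\ v] is connected, [bad_tight_red] yields a cover edge from the
    fibre of [u] to [(v, q)], and its end over [u] has value at least 1. *)
Lemma bad_mate W f u v q : two_conn G W -> bad W f -> v \in W -> u \in W ->
  G v u -> 0 < f (v, q) -> exists2 r, 0 < f (u, r) & H (v, q) (u, r).
Proof.
move=> tW bW vW uW vu fq.
have uWv : u \in W :\ v by rewrite !inE uW andbT; apply: contraTneq vu => ->; rewrite adj_irr.
have tR : transversal_on (W :\: (W :\ v)) [set (v, q)].
  by rewrite setDDD1 //; apply: transversal1.
have [le] := bad_tight_red (two_conn_conn tW) (two_connD1 v tW) (subsetDl _ _) bW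
  tR (sdeg1 fq) uWv.
rewrite setDDD1 // dg1 (adj_sym G) vu => e.
have [/existsP [r hr]|nE] := boolP [exists r, H (u, r) (v, q)].
  by exists r; [have := le r; rewrite dg1 hr | rewrite (adj_sym H)].
move: e; rewrite big1 // => r _; rewrite dg1; apply/eqP; rewrite eqb0.
by apply: contra nE => h; apply/existsP; exists r.
Qed.

Lemma bad_supp_le W f u v : two_conn G W -> bad W f -> v \in W -> u \in W ->
  G v u -> #|supp f v| <= #|supp f u|.
Proof.
move=> tW bW vW uW vu; have [HG mH] := GH.
(* By [bad_mate], [pick] succeeds on [supp f v]; the default [q] only serves colours outside it. *)
pose m q := odflt q [pick r | (0 < f (u, r)) && H (v, q) (u, r)].
have mP q : q \in supp f v -> (0 < f (u, m q)) && H (v, q) (u, m q).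
  rewrite inE => fq; rewrite /m; case: pickP => //= no.
  by have [r fr h] := bad_mate tW bW vW uW vu fq; have := no r; rewrite fr h.
rewrite -(card_in_imset (f := m)).
  by apply: subset_leq_card; apply/subsetP => r /imsetP [q /mP /andP [fr _] ->]; rewrite inE.
move=> q q' /mP /andP [_ h] /mP /andP [_ h'] e.
have := mH (u, m q) (v, q) (v, q'); rewrite !(adj_sym H (u, _)) h e h'.
by move=> /(_ isT isT erefl) [].
Qed.

Lemma bad_supp_eq W f u v : two_conn G W -> bad W f -> v \in W -> u \in W ->
  #|supp f v| = #|supp f u|.
Proof.
move=> tW bW vW uW; pose X := [set w in W | #|supp f w| == #|supp f v|].
have XW : X \subset W by apply/subsetP => w; rewrite inE => /andP [].
have [eX|nX] := eqVneq X W; first by move: uW; rewrite -eX inE => /andP [_ /eqP].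
have [|x [y []]] := connP _ _ (two_conn_conn tW) X XW _ nX.
  by apply/set0Pn; exists v; rewrite inE vW /=.
rewrite !inE => /andP [xW /eqP <-] yW + xy; rewrite yW /= eqn_leq.
by rewrite !(bad_supp_le tW bW) // (adj_sym G).
Qed.

(** After [p] is coloured by [q], the set [W :\ p] is still connected and [S :\ p] is a proper
    subset of it, so each nonempty [A] in [S :\ p] has an edge leaving it within [W :\ p]. This is
    the slack that [greedy] needs. *)
Lemma transversal_through W S f p q : two_conn G W -> bad W f -> S \proper W ->
  p \in S -> 0 < f (p, q) ->
  exists R, [/\ transversal_on S R, sdeg H R f & (p, q) \in R].
Proof.
move=> tW [nW dW] SW pS fq; have sSW := proper_sub SW; have pW := subsetP sSW _ pS.
have b : bad (W :\ p) (red H [set (p, q)] f).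
  apply: bad_red nW _ _ (sdeg1 fq); first exact: subsetDl.
    by move=> v vW; apply: dW; apply: (subsetP (subsetDl _ _) _ vW).
  by rewrite setDDD1 //; apply: transversal1.
have [|R tR sR] := @greedy (S :\ p) (red H [set (p, q)] f).
  move=> A AS A0; have [||x [y [xA yW yA xy]]] := connP _ _ (two_connD1 p tW) A _ A0 _.
  - exact: subset_trans AS (setSD _ sSW).
  - case/properP: SW => _ [w wW wS]; have wp : w != p by apply: contraNneq wS => ->.
    apply: contraNneq wS => eA.
    suff : w \in A by move/(subsetP AS); rewrite inE => /andP [].
    by rewrite eA !inE wp.
  exists x => //; apply: leq_trans (b.2 x _); last first.
    by apply: (subsetP (setSD _ sSW)); apply: (subsetP AS).
  apply: proper_card; rewrite properE nb_sub ?(subset_trans AS) ?setSD //=.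
  by apply/subsetPn; exists y; rewrite !in_nb ?yW // (negbTE yA).
exists ([set (p, q)] :|: R); split; last by rewrite !inE eqxx.
  rewrite -(setD1K pS); apply: transversalU (transversal1 p q) tR.
  by rewrite disjoints1 !inE eqxx.
by apply: sdegU sR; apply: sdeg1.
Qed.

Lemma bad_sub W W' R f : W' \subset W -> bad W f -> transversal_on (W :\: W') R ->
  sdeg H R f -> bad W' (red H R f).
Proof.
move=> WW [nW dW]; apply: bad_red => // v vW; apply: dW; exact: (subsetP WW).
Qed.

Lemma supp_red_far A R f c : transversal_on A R -> dg G A c = 0 ->
  supp (red H R f) c = supp f c.
Proof.
move=> tR c0; apply/setP => q; rewrite !inE /red.
have := sum_dg_transversal c tR; rewrite c0 leqn0 sum_nat_eq0 => /forallP /(_ q).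
by move=> /= /eqP ->; rewrite subn0.
Qed.

(** Colour [W :\: W'] through the mate [(p, q)] of [(a, r)]. The vertex [c] keeps its colours, and
    before and after the supports of [a] and [c] have equal size, so [a] loses no colour; yet the
    value of [(a, r)] drops by at least 1. *)
Lemma bad_large_value W W' f c a p r : two_conn G W -> two_conn G W' -> W' \subset W ->
  bad W f -> c \in W' -> dg G (W :\: W') c = 0 -> a \in W' -> p \in W :\: W' ->
  G a p -> 0 < f (a, r) -> 1 < f (a, r).
Proof.
move=> tW tW' WW bW cW' c0 aW' pS ap far; have aW := subsetP WW _ aW'.
have cW := subsetP WW _ cW'; have pW := subsetP (subsetDl _ _) _ pS.
have [q fq h] := bad_mate tW bW aW pW ap far.
have SW : W :\: W' \proper W.
  by rewrite properE subsetDl; apply/subsetPn; exists c; rewrite // inE cW'.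
have [R [tR sR qR]] := transversal_through tW bW SW pS fq.
have bW' := bad_sub WW bW tR sR.
have es : supp (red H R f) a = supp f a.
  apply/eqP; rewrite eqEcard supp_red (bad_supp_eq tW bW aW cW).
  by rewrite (bad_supp_eq tW' bW' aW' cW') (supp_red_far f tR c0) leqnn.
have : r \in supp (red H R f) a by rewrite es inE.
rewrite inE /red subn_gt0; apply: leq_ltn_trans.
by apply/card_gt0P; exists (p, q); rewrite inE qR.
Qed.

(** * Induction over 2-connected sets *)

(** For 2-connected [W] this means a cycle, by [two_conn_cycle]. *)
Definition small W : Prop := {in W, forall v, dg G W v <= 2}.

Lemma bad_remove W f a q c (P : {set V} -> Prop) :
  (forall W1 f1, W1 \proper W -> two_conn G W1 -> bad W1 f1 ->
     (exists2 v, v \in W1 & 1 < #|supp f1 v|) -> P W1) ->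
  bad W f -> two_conn G (W :\ a) -> a \in W -> c \in W :\ a -> 0 < f (a, q) ->
  1 < #|supp (red H [set (a, q)] f) c| -> P (W :\ a).
Proof.
move=> IH bW ta aW cWa fq s2; apply: IH ta _ _; first exact: properD1.
  apply: bad_sub bW _ (sdeg1 fq); first exact: subsetDl.
  by rewrite setDDD1 //; apply: transversal1.
by exists c.
Qed.

Lemma bad_remove_far W f a c (P : {set V} -> Prop) :
  (forall W1 f1, W1 \proper W -> two_conn G W1 -> bad W1 f1 ->
     (exists2 v, v \in W1 & 1 < #|supp f1 v|) -> P W1) ->
  bad W f -> {in W, forall v, 1 < #|supp f v|} ->
  two_conn G (W :\ a) -> a \in W -> c \in W :\ a -> G c a = false -> P (W :\ a).
Proof.
move=> IH bW s2 ta aW cWa ca.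
have /card_gt0P [q] := ltnW (s2 a aW); rewrite inE => fq.
apply: (bad_remove IH bW ta aW cWa fq).
rewrite (supp_red_far f (transversal1 a q)) ?dg1 ?ca //.
by apply: s2; apply: (subsetP (subsetDl _ _) _ cWa).
Qed.

Lemma supp_red1_large f x v : {in supp f v, forall r, 1 < f (v, r)} ->
  supp (red H [set x] f) v = supp f v.
Proof.
move=> f2; apply/eqP; rewrite eqEsubset supp_red; apply/subsetP => r rv.
have := f2 r rv; rewrite inE /red dg1 subn_gt0; case: (H _ _) => //.
exact: ltnW.
Qed.

(** By the matching condition, choosing [p] lowers no value at [u] except that of [r]. *)
Lemma supp_red1_mate f p u r : H (u, r) p -> supp f u :\ r \subset supp (red H [set p] f) u.
Proof.
move=> h; have [_ mH] := GH; apply/subsetP => r'; rewrite !inE /red dg1 => /andP [rr fr].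
case h': (H _ _); last by rewrite subn0.
have := mH p (u, r) (u, r'); rewrite !(adj_sym H p) h h' => /(_ isT isT erefl) [e].
by rewrite e eqxx in rr.
Qed.

(** By induction [W'] has maximum degree 2, since completeness would pass to [W]. For nonadjacent
    [u], [w] in [W'], induction is then applied to [W :\ u]: there [v] has degree at least 3, while
    completeness would give a neighbour of [u] degree at least 3 in [W']. *)
Lemma no_dominating_vertex W W' f v :
  (forall W1 f1, W1 \proper W -> two_conn G W1 -> bad W1 f1 ->
     (exists2 v, v \in W1 & 1 < #|supp f1 v|) -> small W1 \/ is_complete G W1) ->
  two_conn G W -> bad W f -> {in W, forall v, 1 < #|supp f v|} ->
  ~ is_complete G W -> two_conn G W' -> v \in W -> W' = W :\ v ->
  {in W', forall u, G v u} -> False.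
Proof.
move=> IH tW bW s2 ncW tW' vW eW' vdom.
have sW' : {subset W' <= W} by move=> u; rewrite eW' => /setD1P [].
have W'3 : 2 < #|W'| by case/andP: tW'.
(* The colour of [v] must leave two colours at [u]. The values at [u] sum to at least 3: either one
   of them is at least 2, and the mate of its colour does no harm, or there are three colours and
   one may be lost. *)
have [u uW' [q fq sq]] : exists2 u, u \in W' & exists2 q, 0 < f (v, q) &
    1 < #|supp (red H [set (v, q)] f) u|.
  have /card_gt0P [u uW'] := ltnW (ltnW W'3); exists u => //.
  have uW := sW' u uW'; have uv : G u v by rewrite (adj_sym G) vdom.
  have sum3 : 2 < \sum_q f (u, q).
    rewrite (bad_tight (two_conn_conn tW) bW uW) (dgD1 _ u vW) uv -eW'.
    by rewrite add1n ltnS two_conn_dg.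
  have [/existsP [r fr]|nE] := boolP [exists r, 1 < f (u, r)].
    have [q fq h] := bad_mate tW bW uW vW uv (ltnW fr); exists q => //.
    apply: leq_trans (s2 u uW) (subset_leq_card _).
    apply/subsetP => r' r'u; have [->|rr] := eqVneq r' r.
      rewrite inE /red dg1 subn_gt0; apply: leq_ltn_trans fr; exact: leq_b1.
    by apply: (subsetP (supp_red1_mate f h)); rewrite !inE rr; rewrite inE in r'u.
  have /card_gt0P [r ru] := ltnW (s2 u uW).
  have fr : 0 < f (u, r) by rewrite inE in ru.
  have [q fq h] := bad_mate tW bW uW vW uv fr; exists q => //.
  apply: leq_trans (subset_leq_card (supp_red1_mate f h)); apply: card_setD1_gt.
  apply: leq_trans sum3 _; rewrite -sum1_card [leqRHS]big_mkcond /=.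
  apply: leq_sum => r' _; rewrite inE; case: ltnP; last by rewrite leqn0 => /eqP ->.
  by move=> _; rewrite leqNgt; apply: contra nE => fr'; apply/existsP; exists r'.
have ncW' : ~ is_complete G W'.
  move=> cW'; apply: ncW => x y xW yW xy.
  have [xv|xv] := eqVneq x v; first by rewrite xv vdom // eW' !inE yW -xv eq_sym xy.
  have [yv|yv] := eqVneq y v; first by rewrite yv (adj_sym G) vdom // eW' !inE xW -yv xy.
  by apply: cW'; rewrite // eW' !inE ?xv ?yv.
have {u uW' q fq sq} smW' : small W'.
  suff : small W' \/ is_complete G W' by case.
  by rewrite eW' in tW' uW' *; apply: bad_remove IH bW tW' vW uW' fq sq.
have [u [w [uW' wW' uw nuw]]] :
    exists u w, [/\ u \in W', w \in W', u != w & G u w = false].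
  have /completeP/forallPn /= [u] := ncW'; rewrite negb_imply => /andP [uW'].
  case/forallPn => w; rewrite !negb_imply => /and3P [wW' uw /negbTE nuw].
  by exists u, w.
have uW := sW' u uW'; have wW := sW' w wW'.
have vW' : v \notin W' by rewrite eW' !inE eqxx.
have uv : u != v by apply: contraNneq vW' => <-.
have W4 : 3 < #|W| by rewrite (cardsD1 v W) vW -eW'.
(* The vertex [v] dominates [W :\ u], and deleting [v] itself leaves [W' :\ u]. *)
have tWu : two_conn G (W :\ u).
  apply/andP; split; first exact: card_setD1_gt.
  apply/forall_inP => x; have [-> _ | xv xW] := eqVneq x v.
    by rewrite setDDl setUC -setDDl -eW' two_connD1.
  apply: (@conn_dominating _ _ _ v) => [|y]; rewrite !inE; first by rewrite eq_sym xv eq_sym uv.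
  by move=> /and3P [_ _ yW] yv; apply: vdom; rewrite eW' !inE yv.
have wWu : w \in W :\ u by rewrite !inE eq_sym uw.
have W'u2 : 2 < #|W' :\ u|.
  rewrite (cardsD1 w (W' :\ u)) !inE eq_sym uw wW' add1n ltnS.
  apply: leq_trans (two_conn_dg tW' uW') (subset_leq_card _).
  apply/subsetP => y; rewrite !inE => /andP [-> uy]; rewrite andbT.
  by apply/andP; split; apply: contraTneq uy => ->; rewrite ?nuw ?adj_irr.
have W'4 : 3 < #|W'| by rewrite (cardsD1 u W') uW'.
case: (bad_remove_far IH bW s2 tWu uW wWu); first by rewrite (adj_sym G).
  move/(_ v); rewrite !inE eq_sym uv vW leqNgt => /(_ isT) /negP; apply.
  apply: leq_trans W'u2 (subset_leq_card _); apply/subsetP => y.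
  by rewrite !inE => /andP [-> yW']; rewrite sW' // vdom.
move=> cWu; have /card_gt0P [y] := ltnW (two_conn_dg tW' uW').
rewrite inE => /andP [yW' uy]; have := smW' y yW'; rewrite leqNgt => /negP; apply.
apply: leq_trans (card_setD1_gt y W'4) (subset_leq_card _); apply/subsetP => z.
rewrite !inE => /andP [zy zW']; rewrite zW'; have [->|zu] := eqVneq z u.
  by rewrite (adj_sym G).
apply: cWu; rewrite ?inE ?zu ?sW' //; last by rewrite eq_sym.
by rewrite andbT; apply: contraTneq uy => ->; rewrite adj_irr.
Qed.

(** By induction [W'] is complete, as a foot [a] of the ear has degree at least 3 in it. Hence [c]
    is simplicial in [W], and induction makes [W :\ c] complete, so each vertex of [W' :\ c]
    dominates [W]. Thus [W :\ a] is 2-connected, but it is neither complete, as [c] and [p] are not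
    adjacent, nor of maximum degree 2. *)
Lemma no_far_vertex W W' f c :
  (forall W1 f1, W1 \proper W -> two_conn G W1 -> bad W1 f1 ->
     (exists2 v, v \in W1 & 1 < #|supp f1 v|) -> small W1 \/ is_complete G W1) ->
  two_conn G W -> bad W f -> {in W, forall v, 1 < #|supp f v|} ->
  ~ is_complete G W -> two_conn G W' -> W' \proper W ->
  c \in W' -> dg G (W :\: W') c = 0 ->
  {in W', forall a, dg G (W :\: W') a <= 1} -> False.
Proof.
move=> IH tW bW s2 ncW tW' pW' cW' c0 att1; have sW' := proper_sub pW'.
have cW := subsetP sW' _ cW'.
have large a p : a \in W' -> p \in W :\: W' -> G a p ->
    {in supp f a, forall r, 1 < f (a, r)}.
  by move=> aW' pS ap r; rewrite inE; apply: bad_large_value tW tW' sW' bW cW' c0 aW' pS ap.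
have dg4 a p : a \in W' -> p \in W :\: W' -> G a p -> 3 < dg G W a.
  move=> aW' pS ap; have aW := subsetP sW' _ aW'.
  rewrite -(bad_tight (two_conn_conn tW) bW aW).
  have : 2 * 2 <= 2 * #|supp f a| by rewrite leq_mul2l s2.
  move/leq_trans; apply; rewrite -sum1_card big_distrr big_mkcond /=.
  by apply: leq_sum => r _; case: ifP => // /(large a p aW' pS ap).
have [||a [p [aW' pW npW' ap]]] := connP _ _ (two_conn_conn tW) W' sW'.
- by apply/set0Pn; exists c.
- by apply: contraTneq pW' => ->; rewrite properxx.
have pS : p \in W :\: W' by rewrite inE npW'.
have aW := subsetP sW' _ aW'.
have cS x : x \in W -> x \notin W' -> G c x = false.
  move=> xW xW'; apply: contraTF (leqnn (dg G (W :\: W') c)) => cx.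
  by rewrite {2}c0 -ltnNge; apply/card_gt0P; exists x; rewrite !inE xW xW'.
have dga : 2 < dg G W' a.
  have := dg4 a p aW' pS ap; rewrite (dgD _ a sW'); have := att1 a aW'.
  by case: (dg G (W :\: W') a) => [|[|]] // _; rewrite ?addn0 ?addn1 //; apply: ltnW.
have W'4 : 3 < #|W'| := leq_ltn_trans dga (dg_le_card _ aW').
have cpW' : is_complete G W'.
  have /card_gt0P [q] := ltnW (s2 p pW); rewrite inE => fq.
  have SW : W :\: W' \proper W.
    by rewrite properE subsetDl; apply/subsetPn; exists c; rewrite // inE cW'.
  have [R [tR sR _]] := transversal_through tW bW SW pS fq.
  have [] // := IH W' (red H R f) pW' tW' (bad_sub sW' bW tR sR).
    by exists c; rewrite // (supp_red_far f tR c0) s2.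
  by move/(_ a aW'); rewrite leqNgt dga.
have W3 : 3 < #|W| := leq_trans W'4 (subset_leq_card sW').
have tWc : two_conn G (W :\ c).
  apply/andP; split; first exact: card_setD1_gt.
  apply/forall_inP => x; rewrite !inE => /andP [xc xW].
  rewrite setDDl setUC -setDDl; apply: conn_simplicial (two_connD1 x tW) _.
    by rewrite !inE eq_sym xc.
  have nbW' y : y \in nb G (W :\ x) c -> y \in W'.
    rewrite !inE => /andP [/andP [_ yW] cy]; apply: contraTT cy => yW'.
    by rewrite cS.
  by move=> y z /nbW' yW' /nbW' zW'; apply: cpW'.
have pc : p != c by apply: contraNneq npW' => ->.
have ac : a != c by apply: contraTneq ap => ->; rewrite cS.
have pWc : p \in W :\ c by rewrite !inE pc.
have cpWc : is_complete G (W :\ c).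
  have [] // := bad_remove_far IH bW s2 tWc cW pWc; first by rewrite (adj_sym G) cS.
  move/(_ a); rewrite !inE ac aW leqNgt => /(_ isT) /negP [].
  by apply: dg_setD1_gt; apply: dg4 ap.
have W'c b : b \in W' :\ c -> [/\ b \in W', b \in W :\ c & G b p].
  rewrite !inE => /andP [bc bW']; rewrite bW' bc (subsetP sW' _ bW'); split=> //.
  apply: cpWc; rewrite ?inE ?pc ?bc ?(subsetP sW' _ bW') //.
  by apply: contraNneq npW' => <-.
have dom b y : b \in W' :\ c -> y \in W -> y != b -> G b y.
  case/W'c => bW' bWc _ yW yb; have [->|yc] := eqVneq y c.
    by apply: cpW' => //; move: bWc; rewrite !inE => /andP [].
  have yWc : y \in W :\ c by rewrite !inE yc.
  by apply: cpWc bWc yWc _; rewrite eq_sym.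
have W'ca : 1 < #|W' :\ c :\ a| := card_setD1_gt a (card_setD1_gt c W'4).
have tWa : two_conn G (W :\ a).
  apply/andP; split; first exact: card_setD1_gt.
  apply/forall_inP => x _; have /card_gt0P [b] := card_setD1_gt x W'ca.
  case/setD1P => bx /setD1P [ba bW'c]; have [bW' _ _] := W'c b bW'c.
  apply: (@conn_dominating _ _ _ b) => [|y]; first by rewrite !inE bx ba (subsetP sW').
  by case/setD1P => _ /setD1P [_ yW]; apply: dom.
(* A second foot [b]: its values are at least 2, so it keeps its colours when [a] is coloured, and
   its degree in [W] is at least 4. *)
have /card_gt0P [b /setD1P [ba bW'c]] := ltnW W'ca.
have [bW' /setD1P [_ bW''] bp] := W'c b bW'c.
have /card_gt0P [q] := ltnW (s2 a aW); rewrite inE => fq.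
have bWa : b \in W :\ a by rewrite !inE ba.
case: (bad_remove IH bW tWa aW bWa fq).
- by rewrite (supp_red1_large _ (large b p bW' pS bp)) s2.
- move/(_ b bWa); rewrite leqNgt => /negP []; apply: dg_setD1_gt; exact: dg4 bp.
have cWa : c \in W :\ a by rewrite !inE eq_sym ac.
have pWa : p \in W :\ a by rewrite !inE pW andbT; apply: contraNneq npW' => ->.
by move/(_ c p cWa pWa); rewrite eq_sym pc cS // => /(_ isT).
Qed.

(** An ear of one vertex that misses some vertex of [W'] meets the hypotheses of [no_far_vertex] as
    well. *)
Lemma bad_two_conn W f : two_conn G W -> bad W f ->
  (exists2 v, v \in W & 1 < #|supp f v|) -> small W \/ is_complete G W.
Proof.
have [n] := ubnP #|W|; elim: n W f => // n IHn W f; rewrite ltnS => Wn tW bW [v0 v0W s0].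
have IH W1 f1 : W1 \proper W -> two_conn G W1 -> bad W1 f1 ->
    (exists2 v, v \in W1 & 1 < #|supp f1 v|) -> small W1 \/ is_complete G W1.
  by move=> /proper_card/leq_trans/(_ Wn); apply: IHn.
have s2 : {in W, forall v, 1 < #|supp f v|}.
  by move=> v vW; rewrite (bad_supp_eq tW bW vW v0W).
have [cW|ncW] := completeP G W; [by right | left].
have [/forall_inP //|/forall_inPn [x xW]] := boolP [forall v in W, dg G W v <= 2].
rewrite -ltnNge => x3; case: ncW.
have [W0 t0 p0] := two_conn_proper_sub tW xW x3.
pose ok T := two_conn G T && (T \proper W).
have ok0 : ok W0 by rewrite /ok t0.
case: (@arg_maxnP _ W0 ok (fun T => #|T|) ok0) => W' /andP [tW' pW'] maxW'.
have maxT T : two_conn G T -> T \proper W -> #|T| <= #|W'|.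
  by move=> tT pT; apply: maxW'; rewrite /ok tT.
apply/completeP/negPn/negP => /completeP ncW.
have [[v Sv] | [[c cW' c0] att1]] := two_conn_last_ear tW tW' pW' maxT; last first.
  exact: no_far_vertex IH tW bW s2 ncW tW' pW' cW' c0 att1.
have vW : v \in W by have := set11 v; rewrite -Sv inE => /andP [].
have eW' : W' = W :\ v by rewrite -Sv setDDr setDv set0U (setIidPr (proper_sub pW')).
have [/forall_inP vdom|/forall_inPn [c cW' vc]] := boolP [forall u in W', G v u].
  exact: no_dominating_vertex IH tW bW s2 ncW tW' vW eW' vdom.
apply: (no_far_vertex IH tW bW s2 ncW tW' pW' cW') => [|a _]; rewrite Sv dg1.
  by rewrite (adj_sym G) (negbTE vc).
exact: leq_b1.
Qed.

End CoverTheory.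

(** * From a minimal pair to a bad pair on [B] *)

Unset Implicit Arguments.

Theorem theorem4p5 (V : finType) (G : sgraph V) (s : nat) (s_gt0 : 0 < s)
    (H : sgraph (V * 'I_s)%type) (f : V * 'I_s -> nat) (B : {set V}) :
  is_cover G H ->
  minimal_non_sd H f ->
  B != set0 ->
  B \subset large_value_set G f ->
  (forall x, ~ cut_vertex G B x) ->
  is_cycle G B \/ is_complete G B \/
  (forall v, v \in B -> deg (induced G B) v <= \max_(q < s) f (v, q)).
Proof.
move=> GH [nH mH] /set0Pn [v0 v0B] /subsetP BD nocut.
have dgT v : dg G [set: V] v = deg G v by apply: eq_card => y; rewrite !inE.
(* The transversal over all vertices but [v0] restricts to [~: B] because [v0] lies in [B]. *)
have [f' bB f'f] : exists2 f', bad G H B f' & forall x, f' x <= f x.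
  have [R [tR /sdegP sR]] := mH v0.
  have sB : ~: B \subset [set~ v0].
    by apply/subsetP => v; rewrite !inE; apply: contraNneq => ->.
  exists (red H [set p in R | p.1 \in ~: B] f); last by move=> x; apply: leq_subr.
  apply: (bad_red GH (subsetT B)).
  - by move/solvableP.
  - by move=> v /BD; rewrite inE dgT.
  - by rewrite setTD; apply: transversal_sub tR.
  - by apply: sdegW sR; apply/subsetP => p; rewrite inE => /andP [].
(* At most two vertices form a complete graph or a nonadjacent pair, whose degrees are 0. *)
have [B3|B2] := ltnP 2 #|B|; last first.
  have [cB|/completeP] := completeP G B; first by right; left.
  case/forallPn => x; rewrite negb_imply => /andP [xB].
  case/forallPn => y; rewrite !negb_imply => /and3P [yB xy nxy].
  have eB : B = [set x; y].
    by apply/esym/eqP; rewrite eqEcard subUset !sub1set xB yB cards2 xy.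
  right; right => v vB; rewrite deg_induced // {1}eB.
  suff -> : dg G [set x; y] v = 0 by [].
  apply: eq_card0 => z; rewrite !inE; apply/negP => /andP [].
  move: vB; rewrite eB => /set2P [] -> /pred2P [] ->; rewrite ?adj_irr ?(negbTE nxy) //.
  by rewrite (adj_sym G) (negbTE nxy).
have tB : two_conn G B.
  apply/andP; split=> //; apply/forall_inP => x xB; apply/negPn/negP => ncx.
  by apply: (nocut x); split=> // /conn_on; apply/negP.
have [/exists_inP s2|/exists_inPn s1] := boolP [exists v in B, 1 < #|supp f' v|].
  by have [smB|cB] := bad_two_conn GH tB bB s2; [left; apply: two_conn_cycle | right; left].
right; right => v vB; rewrite deg_induced //.
apply: leq_trans (bB.2 v vB) _.
(* With at most one colour of positive value, the sum is a single value of [f'], which is bounded by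
   [f]. *)
have /card_le1_eqP s1v : #|supp f' v| <= 1 by rewrite leqNgt s1.
have [/existsP [q fq]|/existsPn no] := boolP [exists q, 0 < f' (v, q)]; last first.
  by rewrite big1 // => q _; have := no q; rewrite lt0n negbK => /eqP.
apply: leq_trans (leq_bigmax_cond (F := fun q => f (v, q)) q isT).
rewrite (bigD1 q) //= big1 ?addn0 // => r rq; apply/eqP; rewrite -leqn0 leqNgt.
by apply: contra rq => fr; apply/eqP; apply: s1v; rewrite inE.
Qed.
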